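(* Let $l\ge1$ be an integer and $(a_0,\dots,a_{l-1})\in\mathbb{R}^l$, and consider the planar system given in polar coordinates $(\rho,\varphi)$ by $$\dot\rho=-\rho\left(\rho^{-2l}+\sum_{j=0}^{l-1}a_j\rho^{-2j}\right),\qquad\dot\varphi=1.$$ Suppose this system has a limit cycle $\rho=\rho_0$ ($\rho_0>0$) of multiplicity $m$, $1\le m\le l$. Let $\Gamma_1$ and $\Gamma_2$ be parts of two trajectories of the system near the limit cycle, from outside and from inside respectively. Then $\Gamma_1$ and $\Gamma_2$ are comparable (a) with exponential spirals $\rho=\rho_0\pm e^{-\beta\varphi}$ of limit cycle type when $m=1$, for some constant $\beta\neq0$ depending only on $a_0,\dots,a_{l-1}$; (b) with power spirals $\rho=\rho_0\pm\varphi^{-1/(m-1)}$ when $m>1$. In both cases $\dim_B\Gamma_i=2-\frac1m$ for $i=1,2$.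
   Context: The multiplicity of the limit cycle $\rho=\rho_0$ is the multiplicity of $\rho_0$ as a zero of the function $\rho\mapsto\rho^{-2l}+\sum_{j=0}^{l-1}a_j\rho^{-2j}$. A spiral $\rho=F(\varphi)$ near the circle $\rho=\rho_0$ is comparable with $\rho=\rho_0\pm G(\varphi)$ if there are constants $c_1,c_2>0$ with $c_1G(\varphi)\le|F(\varphi)-\rho_0|\le c_2G(\varphi)$ for all $\varphi$ in the end of the range of angles along which the spiral accumulates on the circle. For a nonempty bounded $B\subset\mathbb{R}^2$, with $B_\varepsilon$ its $\varepsilon$-neighbourhood and $|B_\varepsilon|$ its area, $\overline{\dim}_BB=\inf\{s:\limsup_{\varepsilon\to0}|B_\varepsilon|/\varepsilon^{2-s}=0\}$, $\underline{\dim}_BB$ is the same with $\liminf$, and $\dim_BB$ is their common value. *)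

(* Defs.v *)
From HB Require Import structures.
From mathcomp Require Import all_boot all_order all_algebra.
From mathcomp Require Import all_classical all_reals all_analysis.
Set Implicit Arguments. Unset Strict Implicit. Unset Printing Implicit Defensive.
Import Order.TTheory GRing.Theory Num.Theory.
Import numFieldNormedType.Exports.
Local Open Scope classical_set_scope.
Local Open Scope ring_scope.

Definition cyc_fun (R : realType) (l : nat) (a : 'I_l -> R) (rho : R) : R :=
  rho ^- (2 * l) + \sum_(j < l) a j * rho ^- (2 * j).

Definition zero_mult (R : realType) (g : R -> R) (rho0 : R) (m : nat) : Prop :=
  (forall k, (k < m)%N -> derive1n k g rho0 = 0) /\ derive1n m g rho0 != 0.

Definition ray (R : realType) (up : bool) (phi0 phi : R) : Prop :=
  if up then phi0 <= phi else phi <= phi0.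

Definition ray_end (R : realType) (up : bool) : set_system R :=
  if up then pinfty_nbhs R else ninfty_nbhs R.

(* A part of a trajectory of  rho' = - rho g(rho), phi' = 1, written as a
   spiral rho = F(phi) for phi in the ray, accumulating on the circle rho = rho0
   at the end of the ray. *)
Definition traj_part (R : realType) (l : nat) (a : 'I_l -> R) (rho0 : R)
    (up : bool) (phi0 : R) (F : R -> R) : Prop :=
  (forall phi, ray up phi0 phi -> 0 < F phi) /\
  (forall phi, ray up phi0 phi ->
     is_derive phi (1 : R) F (- (F phi * cyc_fun a (F phi)))) /\
  (F x @[x --> @ray_end R up] --> rho0).

Definition spiral (R : realType) (up : bool) (phi0 : R) (F : R -> R) : set (R * R) :=
  [set (F phi * cos phi, F phi * sin phi) | phi in ray up phi0].

Definition spiral_comparable (R : realType) (up : bool) (rho0 : R) (F G : R -> R) : Prop :=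
  exists c1 c2 : R, 0 < c1 /\ 0 < c2 /\
    \forall phi \near @ray_end R up,
      c1 * G phi <= `|F phi - rho0| /\ `|F phi - rho0| <= c2 * G phi.

Definition dist2 (R : realType) (x y : R * R) : R :=
  Num.sqrt ((x.1 - y.1) ^+ 2 + (x.2 - y.2) ^+ 2).

Definition eps_nbhd (R : realType) (B : set (R * R)) (eps : R) : set (R * R) :=
  [set x | exists2 b, B b & dist2 x b < eps].

Definition area (R : realType) (A : set (R * R)) : \bar R :=
  ((@lebesgue_measure R) \x (@lebesgue_measure R))%E A.

Definition box_ratio (R : realType) (B : set (R * R)) (s : R) (eps : R) : \bar R :=
  (area (eps_nbhd B eps) * ((eps `^ (2 - s))^-1)%:E)%E.

Definition upper_box_dim (R : realType) (B : set (R * R)) : \bar R :=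
  ereal_inf [set s%:E | s in
    [set s : R | limf_esup (box_ratio B s) (0 : R)^'+ = 0%E]].

Definition lower_box_dim (R : realType) (B : set (R * R)) : \bar R :=
  ereal_inf [set s%:E | s in
    [set s : R | limf_einf (box_ratio B s) (0 : R)^'+ = 0%E]].

Definition box_dim_eq (R : realType) (B : set (R * R)) (d : R) : Prop :=
  upper_box_dim B = d%:E /\ lower_box_dim B = d%:E.

(* Main.v *)
(* Write w = |F - rho0| in the direction of time in which the spiral accumulates.
   The limit cycle being a zero of order m gives w' = - w^m K with K -> kappa > 0.
   For m = 1 this makes ln w + kappa phi bounded, for m > 1 it gives
   w^(1-m) ~ (m-1) kappa phi.
   For the box dimension, a real exponent p > 1, p >= m, gives w = O(phi^(-1/(p-1))):
   the eps-neighbourhood of the turns before the angle eps^(1/p-1) and that of the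
   remaining ones, which lie in an annulus of width O(eps^(1/p)), both have area
   O(eps^(1/p)).  Conversely consecutive turns at distance w are O(w^m) apart, so an
   annulus of width c eps^(1/m) lies in the eps-neighbourhood.  Letting p tend to m
   treats m = 1, where the area is of order eps ln(1/eps), together with m > 1. *)
Require Import Defs.
From HB Require Import structures.
From mathcomp Require Import all_boot all_order all_algebra.
From mathcomp Require Import all_classical all_reals all_analysis.
From mathcomp Require Import ring lra.
Import Order.TTheory GRing.Theory Num.Theory.
Import numFieldNormedType.Exports.
Local Open Scope classical_set_scope.
Local Open Scope ring_scope.

(** * Differentiation rules for functions given pointwise *)

Section pointwise_derivatives.
Context {R : realType}.
Implicit Types (f g : R -> R) (x df dg : R).

Lemma is_derive_mulf f g x df dg : is_derive x 1 f df -> is_derive x 1 g dg ->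
  is_derive x 1 (fun y => f y * g y) (f x * dg + g x * df).
Proof. by move=> ? ?; exact: (is_deriveM (f := f) (g := g)). Qed.

Lemma is_derive_addf f g x df dg : is_derive x 1 f df -> is_derive x 1 g dg ->
  is_derive x 1 (fun y => f y + g y) (df + dg).
Proof. by move=> ? ?; exact: (is_deriveD (f := f) (g := g)). Qed.

Lemma is_derive_expf f n x df : is_derive x 1 f df ->
  is_derive x 1 (fun y => f y ^+ n) (n%:R * f x ^+ n.-1 * df).
Proof.
move=> fx; rewrite (_ : (fun y => _) = f ^+ n); first exact: is_deriveX.
by apply/funext => y; rewrite exprfctE.
Qed.

Lemma is_derive_mulr c x : is_derive x 1 (fun y : R => c * y) c.
Proof.
have := is_derive_mulf (cst c) id x 0 1 (is_derive_cst _ _ _) (is_derive_id _ _).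
by rewrite /cst mulr1 mulr0 addr0.
Qed.

End pointwise_derivatives.

(** * Factorization of the radial field at the limit cycle *)

Lemma zero_mult_inj (R : realType) (g : R -> R) (x0 : R) (m n : nat) :
  zero_mult g x0 m -> zero_mult g x0 n -> m = n.
Proof.
move=> [gm gm0] [gn gn0]; case: (ltngtP m n) => // [/gn|/gm] /eqP gE.
- by rewrite gE in gm0.
- by rewrite gE in gn0.
Qed.

(* The shape [(x - x0)^k Q(x) x^-N] is stable under differentiation. *)
Lemma zero_mult_poly (R : realType) (x0 : R) (k N : nat) (Q : {poly R}) (g : R -> R) :
  0 < x0 -> Q.[x0] != 0 ->
  (forall x, 0 < x -> g x = (x - x0) ^+ k * Q.[x] * x ^- N) -> zero_mult g x0 k.
Proof.
move=> x0_gt0; elim: k N Q g => [|k IHk] N Q g Qx0 gE.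
  split=> //; rewrite derive1n0 gE// expr0 mul1r mulf_neq0//.
  by rewrite invr_neq0// expf_neq0// gt_eqF.
(* [Q1] is what remains of the derivative after [(x - x0)^k x^-(N+1)] is taken out. At [x0] only its
   first term survives, with value [(k+1) x0 Q(x0)], which is nonzero. *)
pose Q1 := k.+1%:R *: ('X * Q) + ('X - x0%:P) * ('X * Q^`() - N%:R *: Q).
have g'E x : 0 < x -> derive1 g x = (x - x0) ^+ k * Q1.[x] * x ^- N.+1.
  move=> x_gt0; have x_neq0 : x != 0 by rewrite gt_eqF.
  have HN : is_derive x (1 : R) (fun y : R => y ^+ N) (N%:R * x ^+ N.-1).
    by have := is_derive_expf id N x 1 (is_derive_id _ _); rewrite mulr1.
  have HV := @is_deriveV _ (fun y : R => y ^+ N) x _ 1 (expf_neq0 N x_neq0) HN.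
  have HB : is_derive x (1 : R) (fun y : R => (y - x0) ^+ k.+1)
      (k.+1%:R * (x - x0) ^+ k).
    have := is_derive_expf _ k.+1 x _ (is_derive_addf _ _ x _ _
      (is_derive_id x 1) (is_derive_cst (- x0) x 1)).
    by rewrite addr0 mulr1.
  have HQ := is_derive_poly Q x.
  rewrite derive1E; apply: derive_val.
  apply: (near_eq_is_derive (f := fun y => (y - x0) ^+ k.+1 * Q.[y] * y ^- N)).
    near=> y; apply/esym/gE; near: y; exact: lt_nbhsr.
  apply: is_derive_eq (is_derive_mulf _ _ _ _ _ (is_derive_mulf _ _ _ _ _ HB HQ) HV) _.
  rewrite /GRing.scale/= /Q1 !hornerE /= exprS.
  (* The power rule produces [N.-1], which is truncated at [N = 0]; hence the separate case. *)
  case: N {IHk gE Q1 HN HV} => [|N] /=.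
    by rewrite expr0 expr1 !mul0r; field.
  rewrite !exprS; field.
  by rewrite expf_neq0 ?x_neq0.
have [H0 H1] : zero_mult (derive1 g) x0 k.
  apply: (IHk N.+1 Q1) => //; rewrite /Q1 !hornerE /= subrr mul0r addr0.
  by rewrite !mulf_neq0// ?gt_eqF// pnatr_eq0.
split=> [[|j] jk|]; last by rewrite derive1Sn.
- by rewrite derive1n0 gE// subrr expr0n !mul0r.
- by rewrite derive1Sn H0.
Unshelve. all: by end_near. Qed.

(** Multiplication by [x^(2l)] turns [cyc_fun a] into a polynomial, from which the full power of
    [X - x0] can be extracted. The exponent is [m] because the order of a zero is unique. The factor
    [x] of the radial equation is absorbed into [k]. *)
Lemma cyc_fun_factor (R : realType) (l : nat) (a : 'I_l -> R) (x0 : R) (m : nat) :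
  0 < x0 -> zero_mult (cyc_fun a) x0 m ->
  exists k : R -> R, [/\ forall x, 0 < x -> derivable k x 1, k x0 != 0 &
    forall x, 0 < x -> x * cyc_fun a x = (x - x0) ^+ m * k x].
Proof.
move=> x0_gt0 gm.
pose P : {poly R} := 1 + \sum_(j < l) a j *: 'X^(2 * (l - j)).
have gP x : 0 < x -> cyc_fun a x = P.[x] * x ^- (2 * l).
  move=> x_gt0; rewrite /cyc_fun hornerD hornerC horner_sum mulrDl mul1r.
  congr (_ + _); rewrite mulr_suml; apply: eq_bigr => j _.
  rewrite hornerZ hornerXn -mulrA; congr (_ * _).
  have -> : (2 * l = 2 * (l - j) + 2 * j)%N.
    by rewrite -mulnDr subnK// ltnW.
  rewrite exprD invfM mulrA divff ?mul1r//.
  by rewrite expf_neq0// gt_eqF.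
(* All exponents [2 (l - j)] are positive, so [P(0) = 1]. *)
have P0 : P != 0.
  apply: contraTneq isT => /(congr1 (fun p : {poly R} => p.[0])).
  rewrite hornerD hornerC horner_sum big1 ?addr0 ?horner0.
    by move=> /eqP; rewrite oner_eq0.
  move=> j _; rewrite hornerZ hornerXn expr0n.
  by rewrite muln_eq0 /= subn_eq0 leqNgt ltn_ord mulr0.
have [n [Q]] := multiplicity_XsubC P x0; rewrite P0 /= => Qx0 PE.
have gE x : 0 < x -> cyc_fun a x = (x - x0) ^+ n * Q.[x] * x ^- (2 * l).
  by move=> /gP->; rewrite PE hornerM horner_exp hornerXsubC (mulrC Q.[x]).
have -> : m = n by apply: (zero_mult_inj _ _ _ _ _ gm); apply: zero_mult_poly gE.
exists (fun x => x * (Q.[x] * x ^- (2 * l))); split=> [x x_gt0||x x_gt0].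
- apply: derivableM => //; apply: derivableM; first exact: derivable_horner.
  apply: derivableV; first by rewrite expf_neq0// gt_eqF.
  exact: exprn_derivable.
- by rewrite !mulf_neq0// ?invr_neq0 ?expf_neq0// gt_eqF.
- by rewrite gE//; ring.
Qed.

(** * Monotonicity and limits on half-lines *)

Section derivatives_on_rays.
Context {R : realType}.
Implicit Types (f df : R -> R) (T : R).

Lemma within_continuous_is_derive f df (i : interval R) :
  (forall t, t \in i -> is_derive t 1 f (df t)) -> {within [set` i], continuous f}.
Proof.
by move=> fdf; apply: derivable_within_continuous => t /fdf /@ex_derive.
Qed.

Lemma nondecreasing_on_ray f df T :
  (forall t, T <= t -> is_derive t 1 f (df t)) -> (forall t, T <= t -> 0 <= df t) ->
  forall s t, T <= s -> s <= t -> f s <= f t.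
Proof.
move=> fdf df0; apply: ger0_derive1_ndecry => [t|t|].
- by rewrite in_itv/= andbT => /ltW/fdf/@ex_derive.
- rewrite in_itv/= andbT => /ltW Tt; have ft := fdf _ Tt.
  by rewrite derive1E derive_val df0.
- apply: (within_continuous_is_derive _ df) => t.
  by rewrite in_itv/= andbT => /fdf.
Qed.

Lemma nonincreasing_on_ray f df T :
  (forall t, T <= t -> is_derive t 1 f (df t)) -> (forall t, T <= t -> df t <= 0) ->
  forall s t, T <= s -> s <= t -> f t <= f s.
Proof.
move=> fdf df0 s t Ts st; rewrite -lerN2.
apply: (nondecreasing_on_ray (fun x => - f x) (fun x => - df x) T) => // x Tx.
  by have fx := fdf _ Tx; exact: is_deriveN.
by rewrite oppr_ge0 df0.
Qed.

Lemma cvg_ge_ray f T (l c : R) :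
  f t @[t --> +oo] --> l -> (forall t, T <= t -> c <= f t) -> c <= l.
Proof.
move=> fl cf; rewrite leNgt; apply/negP => lc.
near (pinfty_nbhs R) => t.
have Tt : T <= t by near: t; exact: (nbhs_pinfty_ge (num_real _)).
suff /(le_lt_trans (cf _ Tt)) : f t < c by rewrite ltxx.
near: t; exact: (cvgr_lt l).
Unshelve. all: by end_near. Qed.

End derivatives_on_rays.

(** * Decay rates for the radial equation *)

Section radial_equation.
Context {R : realType}.
Implicit Types (w K D : R -> R) (T : R).

(** With [kappa < 0] the distance [w] would eventually be nondecreasing, and a positive function of
    this kind cannot tend to 0. *)
Lemma radial_rate_gt0 m w K T kappa : (forall t, T <= t -> 0 < w t) ->
  (forall t, T <= t -> is_derive t 1 w (- (w t ^+ m * K t))) ->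
  w t @[t --> +oo] --> 0 -> K t @[t --> +oo] --> kappa -> kappa != 0 -> 0 < kappa.
Proof.
move=> w0 dw wl Kl kappa0; rewrite lt_neqAle eq_sym kappa0/= leNgt; apply/negP => kappa_lt0.
have [A [_ AK]] : \forall x \near +oo, K x < 0 by exact: (cvgr_lt kappa).
pose S := Num.max T (A + 1).
have TS : T <= S by rewrite le_max lexx.
have KS t : S <= t -> K t < 0.
  by rewrite ge_max => /andP[_ At]; apply: AK; rewrite (lt_le_trans _ At)// ltrDl.
suff : w S <= 0 by rewrite leNgt w0.
apply: (cvg_ge_ray w S) wl _ => t St.
apply: (nondecreasing_on_ray w (fun t => - (w t ^+ m * K t)) S) => // u Su.
  by apply: dw; exact: le_trans Su.
rewrite oppr_ge0 mulr_ge0_le0//; last by rewrite ltW// KS.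
by rewrite exprn_ge0// ltW// w0// (le_trans TS).
Qed.

(* [ln w + kappa t] is controlled because [ln w + kappa t - C w] increases and
   [ln w + kappa t + C w] decreases, for [C = 2 L / kappa]. *)
Lemma radial_exponential w K T kappa L : 0 < kappa -> 0 <= L ->
  (forall t, T <= t -> 0 < w t) ->
  (forall t, T <= t -> is_derive t 1 w (- (w t * K t))) ->
  (forall t, T <= t -> kappa / 2 <= K t) ->
  (forall t, T <= t -> `|K t - kappa| <= L * w t) ->
  exists c1 c2 : R, [/\ 0 < c1, 0 < c2 &
    forall t, T <= t -> c1 * expR (- (kappa * t)) <= w t <= c2 * expR (- (kappa * t))].
Proof.
move=> kappa0 L0 w0 dw Kge Klip; pose C := 2 * L / kappa.
have C0 : 0 <= C by rewrite /C divr_ge0 ?mulr_ge0// ltW.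
have dv s t : T <= t -> is_derive t 1 (fun x => ln (w x) + kappa * x + s * w x)
    ((w t)^-1 * (- (w t * K t)) + kappa + s * (- (w t * K t))).
  move=> Tt; have dwt := dw _ Tt.
  apply: is_derive_addf; apply: is_derive_addf; last exact: is_derive_mulr.
  by apply: (@is_derive1_comp _ (@ln R) w); exact: is_derive1_ln (w0 _ Tt).
have dvE s t : T <= t -> (w t)^-1 * (- (w t * K t)) + kappa + s * (- (w t * K t)) =
    kappa - K t - s * w t * K t.
  by move=> Tt; field; rewrite gt_eqF// w0.
(* The value of [C] is chosen for this: [K >= kappa / 2] gives [C w K >= L w], so the derivative of
   the correction [C w] dominates the error [|K - kappa|]. *)
have wK t : T <= t -> L * w t <= C * w t * K t.
  move=> Tt; have /(ler_wpM2l (mulr_ge0 C0 (ltW (w0 _ Tt)))) := Kge _ Tt.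
  by apply: le_trans; rewrite /C le_eqVlt; apply/orP; left; apply/eqP; field; rewrite gt_eqF.
have up t : T <= t -> ln (w t) + kappa * t <= ln (w T) + kappa * T + C * w T.
  move=> Tt; rewrite (@le_trans _ _ (ln (w t) + kappa * t + C * w t))//.
    by rewrite lerDl mulr_ge0// ltW// w0.
  apply: (nonincreasing_on_ray _ _ T (dv C)) => // x Tx; rewrite dvE//.
  by have := Klip _ Tx; have := wK _ Tx; rewrite ler_norml => ? /andP[]; lra.
have lo t : T <= t -> ln (w T) + kappa * T + (- C) * w T <= ln (w t) + kappa * t.
  move=> Tt; rewrite (@le_trans _ _ (ln (w t) + kappa * t + (- C) * w t))//.
    apply: (nondecreasing_on_ray _ _ T (dv (- C))) => // x Tx; rewrite dvE//.
    by have := Klip _ Tx; have := wK _ Tx; rewrite ler_norml => ? /andP[]; lra.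
  by rewrite gerDl mulNr oppr_le0 mulr_ge0// ltW// w0.
exists (expR (ln (w T) + kappa * T + (- C) * w T)), (expR (ln (w T) + kappa * T + C * w T)).
split; [exact: expR_gt0|exact: expR_gt0|move=> t Tt].
rewrite -!expRD -[X in _ <= X <= _](lnK (w0 _ Tt)) !ler_expR.
by rewrite lerBlDr lo// lerBrDr up.
Qed.

Lemma is_derive_powR_comp w t p dw : 0 < w t -> is_derive t 1 w dw ->
  is_derive t 1 (fun x => w x `^ p) (p * w t `^ (p - 1) * dw).
Proof.
by move=> w0 dwt; apply: (@is_derive1_comp _ (@powR R ^~ p) w); exact: is_derive1_powR.
Qed.

Lemma powR_opp_le (x y r : R) : 0 <= r -> 0 < x -> x <= y -> y `^ (- r) <= x `^ (- r).
Proof.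
move=> r0 x0 xy; rewrite !powRN lef_pV2 ?posrE ?powR_gt0//; last exact: lt_le_trans xy.
by rewrite ge0_ler_powR// nnegrE ltW// (lt_le_trans x0).
Qed.

Lemma powR_inv_root (x p : R) : 1 < p -> 0 < x ->
  x = (x `^ (1 - p)) `^ (- (p - 1)^-1).
Proof.
move=> p1 x0; rewrite -powRrM -[LHS]powRr1 ?ltW//; congr (_ `^ _).
by field; rewrite subr_eq0 gt_eqF.
Qed.

(** The derivative of [w^(1-p)] is [(p-1) w^(-p) D >= c (p-1)], so [w^(1-p)] grows at least
    linearly; the power [-1/(p-1)] reverses this into a bound on [w]. *)
Lemma radial_power_le w D T p c : 1 < p -> 0 < c -> (forall t, T <= t -> 0 < w t) ->
  (forall t, T <= t -> is_derive t 1 w (- D t)) ->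
  (forall t, T <= t -> c * w t `^ p <= D t) ->
  exists2 C, 0 < C & \forall t \near +oo, w t <= C * t `^ (- (p - 1)^-1).
Proof.
move=> p1 c0 w0 dw Dge.
have p10 : 0 < p - 1 by rewrite subr_gt0.
have y_ge t : T <= t ->
    w T `^ (1 - p) + (- (c * (p - 1))) * T <= w t `^ (1 - p) + (- (c * (p - 1))) * t.
  move=> Tt.
  apply: (nondecreasing_on_ray (fun x => w x `^ (1 - p) + (- (c * (p - 1))) * x)
    (fun t => (1 - p) * w t `^ ((1 - p) - 1) * (- D t) + - (c * (p - 1))) T) => // x Tx.
    apply: is_derive_addf; last exact: is_derive_mulr.
    by apply: is_derive_powR_comp; [exact: w0|exact: dw].
  rewrite addrAC subrr add0r.
  have -> : (1 - p) * w x `^ (- p) * - D x + - (c * (p - 1)) =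
    (p - 1) * (w x `^ (- p) * D x - c) by ring.
  apply: mulr_ge0; [exact: ltW|rewrite subr_ge0 powRN mulrC]; rewrite ler_pdivlMr ?powR_gt0 ?w0//.
  exact: Dge.
(* Half of the slope is given up: for [t >= 2T] one has [t - T >= t / 2], which removes the initial
   angle from the bound. *)
exists ((c * (p - 1) / 2) `^ (- (p - 1)^-1)); first by rewrite powR_gt0// divr_gt0 ?mulr_gt0.
near=> t.
have Tt : T <= t by near: t; exact: (nbhs_pinfty_ge (num_real _)).
have t0 : 0 < t by near: t; exact: (nbhs_pinfty_gt (num_real _)).
have T2t : 2 * T <= t by near: t; exact: (nbhs_pinfty_ge (num_real _)).
have cp0 : 0 < c * (p - 1) / 2 by rewrite divr_gt0 ?mulr_gt0.
rewrite [leLHS](powR_inv_root _ p)//; last exact: w0.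
rewrite -(powRM _ (ltW cp0) (ltW t0)); apply: powR_opp_le;
  [by rewrite invr_ge0 ltW|exact: mulr_gt0|].
have : 0 <= c * (p - 1) / 2 * (t - 2 * T) by apply: mulr_ge0; [exact: ltW|rewrite subr_ge0].
have := y_ge _ Tt; have := powR_ge0 (w T) (1 - p); lra.
Unshelve. all: by end_near. Qed.

(** The same computation with reversed inequalities: [w^(1-p)] grows at most linearly. *)
Lemma radial_power_ge w D T p c : 1 < p -> 0 < c -> (forall t, T <= t -> 0 < w t) ->
  (forall t, T <= t -> is_derive t 1 w (- D t)) ->
  (forall t, T <= t -> D t <= c * w t `^ p) ->
  exists2 C, 0 < C & \forall t \near +oo, C * t `^ (- (p - 1)^-1) <= w t.
Proof.
move=> p1 c0 w0 dw Dle.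
have p10 : 0 < p - 1 by rewrite subr_gt0.
have y_le t : T <= t ->
    w t `^ (1 - p) + (- (c * (p - 1))) * t <= w T `^ (1 - p) + (- (c * (p - 1))) * T.
  move=> Tt.
  apply: (nonincreasing_on_ray (fun x => w x `^ (1 - p) + (- (c * (p - 1))) * x)
    (fun t => (1 - p) * w t `^ ((1 - p) - 1) * (- D t) + - (c * (p - 1))) T) => // x Tx.
    apply: is_derive_addf; last exact: is_derive_mulr.
    by apply: is_derive_powR_comp; [exact: w0|exact: dw].
  rewrite addrAC subrr add0r.
  have -> : (1 - p) * w x `^ (- p) * - D x + - (c * (p - 1)) =
    (p - 1) * (w x `^ (- p) * D x - c) by ring.
  apply: mulr_ge0_le0; [exact: ltW|rewrite subr_le0 powRN mulrC]; rewrite ler_pdivrMr ?powR_gt0 ?w0//.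
  exact: Dle.
(* For [t >= 1] the affine bound [w(T)^(1-p) + c (p-1) (t - T)] is at most [A t]; the summand 1
   keeps [A] positive. *)
pose A := w T `^ (1 - p) + c * (p - 1) * (1 + `|T|).
have cp0 : 0 < c * (p - 1) by rewrite mulr_gt0.
have A0 : 0 < A by rewrite /A ltr_pwDr ?powR_ge0// mulr_gt0// ltr_pwDl.
exists (A `^ (- (p - 1)^-1)); first by rewrite powR_gt0.
near=> t.
have Tt : T <= t by near: t; exact: (nbhs_pinfty_ge (num_real _)).
have t1 : 1 <= t by near: t; exact: (nbhs_pinfty_ge (num_real _)).
have t0 : 0 < t by exact: lt_le_trans t1.
rewrite [leRHS](powR_inv_root _ p)//; last exact: w0.
rewrite -(powRM _ (ltW A0) (ltW t0)); apply: powR_opp_le;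
  [by rewrite invr_ge0 ltW|by rewrite powR_gt0// w0|].
rewrite /A.
have H1 : 0 <= w T `^ (1 - p) * (t - 1) by rewrite mulr_ge0 ?powR_ge0// subr_ge0.
have H2 : - T <= `|T| * t.
  apply: (@le_trans _ _ `|T|); first by rewrite -normrN ler_norm.
  by rewrite ler_peMr.
have := y_le _ Tt; have := ler_wpM2l (ltW cp0) H2; lra.
Unshelve. all: by end_near. Qed.

End radial_equation.

(** * Measurability and area estimates in the plane *)

Section planar_area.
Context {R : realType}.
Implicit Types (U A B : set (R * R)) (d e : R).

(** An open set is the union of the rational open rectangles inside it, a countable family of
    measurable sets for the product structure. Rectangles not inside [U] are replaced by the empty
    set, so that the union runs over all rational quadruples. *)
Lemma measurable_planar_open U :
  (forall x, U x -> exists2 e, 0 < e &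
     forall y : R * R, `|y.1 - x.1| < e -> `|y.2 - x.2| < e -> U y) -> measurable U.
Proof.
move=> Uo.
pose F (p q r s : rat) : set (R * R) :=
  `](ratr p : R), ratr q[%classic `*` `](ratr r : R), ratr s[%classic.
have -> : U = \bigcup_p \bigcup_q \bigcup_r \bigcup_s
    (if `[< F p q r s `<=` U >] then F p q r s else set0).
  apply/seteqP; split=> [x Ux|x [p _ [q _ [r _ [s _]]]]]; last first.
    by case: asboolP => // + Fx; apply.
  have [e e0 eU] := Uo _ Ux.
  have /rat_in_itvoo[p] : x.1 - e < x.1 by rewrite ltrBlDr ltrDl.
  rewrite in_itv/= => /andP[p1 p2].
  have /rat_in_itvoo[q] : x.1 < x.1 + e by rewrite ltrDl.
  rewrite in_itv/= => /andP[q1 q2].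
  have /rat_in_itvoo[r] : x.2 - e < x.2 by rewrite ltrBlDr ltrDl.
  rewrite in_itv/= => /andP[r1 r2].
  have /rat_in_itvoo[s] : x.2 < x.2 + e by rewrite ltrDl.
  rewrite in_itv/= => /andP[s1 s2].
  exists p => //; exists q => //; exists r => //; exists s => //.
  rewrite asboolT; first by split; rewrite /= in_itv/=; apply/andP.
  move=> y [/=]; rewrite !in_itv/= => /andP[y1 y2] /andP[y3 y4].
  by apply: eU; rewrite ltr_norml; apply/andP; split; lra.
do 4 (apply: bigcupT_measurable_rat => ?).
by case: ifP => // _; apply: measurableX; exact: measurable_itv.
Qed.

Lemma area_setU A B : measurable A -> measurable B -> (area (A `|` B) <= area A + area B)%E.
Proof. by move=> mA mB; exact: measureU2. Qed.

Lemma area_le_squares A n (c : nat -> R * R) d : measurable A -> 0 <= d ->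
  (forall x, A x -> exists2 i, (i < n)%N &
     `|x.1 - (c i).1| <= d /\ `|x.2 - (c i).2| <= d) ->
  (area A <= (n%:R * (2 * d) ^+ 2)%:E)%E.
Proof.
move=> mA d0 Ac.
pose Q i : set (R * R) := `[(c i).1 - d, (c i).1 + d]%classic `*`
  `[(c i).2 - d, (c i).2 + d]%classic.
have mQ i : measurable (Q i) by apply: measurableX; exact: measurable_itv.
have aQ i : area (Q i) = ((2 * d) ^+ 2)%:E.
  rewrite /area /Q product_measure1E//=; try exact: measurable_itv.
  rewrite !lebesgue_measure_itv/= !lte_fin.
  (* The length formula for an interval tests whether its end points are strictly ordered, so
     degenerate squares are treated apart. *)
  have [->|d_neq0] := eqVneq d 0.
    by rewrite !subr0 !addr0 !ltxx mul0e mulr0 expr0n.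
  have d_gt0 : 0 < d by rewrite lt_neqAle eq_sym d_neq0.
  rewrite !ifT; [|by lra|by lra].
  by rewrite -!EFinB -EFinM; congr EFin; ring.
have -> : ((n%:R * (2 * d) ^+ 2)%:E = \sum_(k < n) area (Q k))%E.
  rewrite (eq_bigr (fun=> ((2 * d) ^+ 2)%:E)) => [|i _]; last exact: aQ.
  by rewrite sumEFin sumr_const card_ord mulr_natl.
apply: content_subadditive => [k _| |x /Ac[i ltin [x1 x2]]]; [exact: mQ|exact: mA|].
rewrite -bigcup_mkord; exists i => //.
by split; rewrite /= in_itv/=; move: x1 x2; rewrite !ler_norml => /andP[? ?] /andP[? ?];
  apply/andP; split; lra.
Qed.

(** The curve is sampled with step [d]. Each of its points is within [M d] of the preceding sample,
    so the squares of half-side [(M + 1) d] about the samples cover [A]; there are at most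
    [(b - a) / d + 1] of them. *)
Lemma area_le_curve A (g : R -> R * R) a b M d : measurable A -> a <= b -> 0 < d -> 0 <= M ->
  (forall s t, a <= s -> s <= t -> t <= b ->
     `|(g t).1 - (g s).1| <= M * (t - s) /\ `|(g t).2 - (g s).2| <= M * (t - s)) ->
  (forall x, A x -> exists2 t, a <= t <= b & `|x.1 - (g t).1| <= d /\ `|x.2 - (g t).2| <= d) ->
  (area A <= (((b - a) / d + 1) * (2 * ((M + 1) * d)) ^+ 2)%:E)%E.
Proof.
move=> mA ab d0 M0 glip Ag.
pose n := (Num.truncn ((b - a) / d)).+1.
have ba0 : 0 <= (b - a) / d by rewrite divr_ge0 ?subr_ge0// ltW.
apply: (@le_trans _ _ (n%:R * (2 * ((M + 1) * d)) ^+ 2)%:E); last first.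
  by rewrite lee_fin ler_wpM2r ?sqr_ge0// -natr1 lerD2r truncn_le.
apply: (area_le_squares _ _ (fun i => g (a + i%:R * d))) => //.
  by rewrite mulr_ge0 ?addr_ge0// ltW.
move=> x /Ag[t /andP[at_ tb] [x1 x2]].
have ta0 : 0 <= (t - a) / d by rewrite divr_ge0 ?subr_ge0// ltW.
have /andP[i1 i2] := truncn_itv ta0; set i := Num.truncn _ in i1 i2.
exists i.
  rewrite ltnS /i truncn_ge_nat// (le_trans i1)//; apply: ler_wpM2r.
    by rewrite invr_ge0 ltW.
  by rewrite lerB.
have {}i1 : i%:R * d <= t - a by rewrite -ler_pdivlMr.
have {}i2 : t - a <= (i%:R + 1) * d by rewrite ltW// -ltr_pdivrMr// natr1.
have ai : a <= a + i%:R * d by rewrite lerDl mulr_ge0// ltW.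
have it : a + i%:R * d <= t by lra.
have tid : M * (t - (a + i%:R * d)) <= M * d by rewrite ler_wpM2l//; lra.
have [g1 g2] := glip _ _ ai it tb.
split.
- rewrite -(subrK (g t).1 x.1) -addrA (le_trans (ler_normD _ _))//; lra.
- rewrite -(subrK (g t).2 x.2) -addrA (le_trans (ler_normD _ _))//; lra.
Qed.

(** A triangle inequality with the displacement measured coordinatewise, which suffices to see that
    [eps_nbhd] is open. It follows by squaring, since each coordinate of [x - b] is at most
    [dist2 x b]. *)
Lemma dist2_triangle (x y b : R * R) :
  dist2 y b <= dist2 x b + (`|y.1 - x.1| + `|y.2 - x.2|).
Proof.
rewrite /dist2; set u := y.1 - x.1; set v := y.2 - x.2.
have -> : y.1 - b.1 = (x.1 - b.1) + u by rewrite /u; ring.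
have -> : y.2 - b.2 = (x.2 - b.2) + v by rewrite /v; ring.
set p := x.1 - b.1; set q := x.2 - b.2; set s := Num.sqrt (p ^+ 2 + q ^+ 2).
have s0 : 0 <= s by rewrite sqrtr_ge0.
have ss : s ^+ 2 = p ^+ 2 + q ^+ 2 by rewrite sqr_sqrtr// addr_ge0// sqr_ge0.
have ps : `|p| <= s by rewrite -sqrtr_sqr ler_wsqrtr// lerDl sqr_ge0.
have qs : `|q| <= s by rewrite -sqrtr_sqr ler_wsqrtr// lerDr sqr_ge0.
rewrite -[leRHS]ger0_norm ?addr_ge0// -[leRHS]sqrtr_sqr ler_wsqrtr//.
have pu : p * u <= s * `|u|.
  by apply: (le_trans (ler_norm _)); rewrite normrM ler_wpM2r.
have qv : q * v <= s * `|v|.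
  by apply: (le_trans (ler_norm _)); rewrite normrM ler_wpM2r.
have uv : 0 <= `|u| * `|v| by rewrite mulr_ge0.
have := real_normK (num_real u); have := real_normK (num_real v).
by move: ss pu qv uv; lra.
Qed.

Lemma dist2_lt_coord (x b : R * R) e : dist2 x b < e ->
  `|x.1 - b.1| < e /\ `|x.2 - b.2| < e.
Proof.
by move=> xb; split; apply: le_lt_trans xb; rewrite /dist2 -sqrtr_sqr ler_wsqrtr//
  ?lerDl ?lerDr sqr_ge0.
Qed.

Lemma measurable_eps_nbhd B e : measurable (eps_nbhd B e).
Proof.
apply: measurable_planar_open => x [b Bb xb]; exists ((e - dist2 x b) / 2).
  by rewrite divr_gt0// subr_gt0.
move=> y y1 y2; exists b => //; apply: (le_lt_trans (dist2_triangle x y b)).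
lra.
Qed.

Lemma eps_nbhdU A B e : eps_nbhd (A `|` B) e = eps_nbhd A e `|` eps_nbhd B e.
Proof.
apply/seteqP; split=> [x [b [Ab|Bb] xb]|x [] [b Ab xb]].
- by left; exists b.
- by right; exists b.
- by exists b => //; left.
- by exists b => //; right.
Qed.

(* The vertical section at [x] of the annulus contains an interval of length [d]
   starting at [sqrt (r^2 - x^2)]. *)
Lemma area_ge_annulus U r h d : measurable U -> 0 < h -> h <= r -> 0 < d ->
  (forall x y : R, 0 < x -> x < h -> 0 < y -> r ^+ 2 < x ^+ 2 + y ^+ 2 ->
     x ^+ 2 + y ^+ 2 < (r + d) ^+ 2 -> U (x, y)) ->
  ((h * d)%:E <= area U)%E.
Proof.
move=> mU h0 hr d0 Uann.
have r0 : 0 < r by exact: lt_le_trans hr.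
rewrite /area /product_measure1.
apply: (@le_trans _ _ (\int[lebesgue_measure]_(x in `]0%R, h[%classic) (d%:E))%E).
  rewrite integral_cst; last exact: measurable_itv.
  have lh : @lebesgue_measure R `]0%R, h[%classic = h%:E.
    by rewrite lebesgue_measure_itv/= lte_fin h0 oppr0 adde0.
  by rewrite /= lh mulrC EFinM.
have mx := @measurable_fun_xsection _ _ _ _ R (@lebesgue_measure R) U mU.
apply: (@le_trans _ _ (\int[lebesgue_measure]_(x in `]0%R, h[%classic)
    (@lebesgue_measure R \o xsection U) x)%E); last first.
  by apply: ge0_subset_integral => //; exact: measurable_itv.
apply: ge0_le_integral.
- exact: measurable_itv.
- by move=> x _; rewrite lee_fin ltW.
- exact: measurable_cst.
- exact: measurable_funS mx.
- move=> x; rewrite /= in_itv/= => /andP[x0 xh].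
  pose s := Num.sqrt (r ^+ 2 - x ^+ 2).
  have xr : x <= r by exact: le_trans (ltW xh) hr.
  have rx : 0 <= r ^+ 2 - x ^+ 2 by rewrite subr_ge0 ler_sqr ?nnegrE ?(ltW r0) ?(ltW x0).
  have s0 : 0 <= s by rewrite sqrtr_ge0.
  have ss : s ^+ 2 = r ^+ 2 - x ^+ 2 by rewrite sqr_sqrtr.
  (* From [s <= r] follows [x^2 + (s + d)^2 <= (r + d)^2], so the interval from [s] to [s + d] stays
     below the outer circle. *)
  have sr : s <= r by rewrite -ler_sqr ?nnegrE ?(ltW r0)// ss gerBl sqr_ge0.
  apply: (@le_trans _ _ (lebesgue_measure (`]s, s + d[%classic : set R))).
    by rewrite lebesgue_measure_itv/= lte_fin ltrDl d0 -EFinB lee_fin addrAC subrr add0r.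
  apply: le_measure; rewrite ?inE; [exact: measurable_itv|exact: measurable_xsection|].
  move=> y; rewrite /= in_itv/= => /andP[sy ysd]; rewrite /xsection/= inE.
  have y0 : 0 < y by exact: le_lt_trans sy.
  apply: Uann => //.
  + have : s ^+ 2 < y ^+ 2 by rewrite ltr_sqr ?nnegrE ?s0 ?(ltW y0).
    by rewrite ss; lra.
  + have : y ^+ 2 < (s + d) ^+ 2.
      by rewrite ltr_sqr ?nnegrE ?(ltW y0) ?(ltW (lt_trans y0 ysd)).
    have : s * d <= r * d by rewrite ler_wpM2r// ltW.
    by rewrite !sqrrD ss; lra.
Qed.

End planar_area.

(** * Upper bound for the area near a spiral *)

Section polar_curves.
Context {R : realType}.
Implicit Types (G dG : R -> R) (t T sg eps : R).

(** The sign [sg = -1] represents a spiral run through backwards: under [phi = -t] the sine changes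
    sign. All spirals can thus be studied for [t] tending to [+oo]. *)
Definition polar_curve sg G t : R * R := (G t * cos t, sg * (G t * sin t)).

Lemma lipschitz_on_ray G dG T M : (forall t, T <= t -> is_derive t 1 G (dG t)) ->
  (forall t, T <= t -> `|dG t| <= M) ->
  forall s t, T <= s -> s <= t -> `|G t - G s| <= M * (t - s).
Proof.
move=> GdG dGM s t Ts st; have GM k u : T <= u ->
    is_derive u 1 (fun x => G x + k * x) (dG u + k).
  by move=> Tu; have Gu := GdG _ Tu; apply: is_derive_addf; exact: is_derive_mulr.
have := nondecreasing_on_ray _ _ T (GM M).
have := nonincreasing_on_ray _ _ T (GM (- M)).
move=> /(_ _ s t Ts st) Gle /(_ _ s t Ts st) Gge; rewrite ler_norml; apply/andP; split.
- suff : G s + M * s <= G t + M * t by lra.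
  by apply: Gge => u /dGM; rewrite ler_norml => /andP[]; lra.
- suff : G t + - M * t <= G s + - M * s by lra.
  by apply: Gle => u /dGM; rewrite ler_norml => /andP[]; lra.
Qed.

Lemma polar_curve_lipschitz sg G dG T M : `|sg| = 1 ->
  (forall t, T <= t -> is_derive t 1 G (dG t)) ->
  (forall t, T <= t -> `|G t| <= M) -> (forall t, T <= t -> `|dG t| <= M) ->
  forall s t, T <= s -> s <= t ->
    `|(polar_curve sg G t).1 - (polar_curve sg G s).1| <= 2 * M * (t - s) /\
    `|(polar_curve sg G t).2 - (polar_curve sg G s).2| <= 2 * M * (t - s).
Proof.
move=> sg1 GdG GM dGM s t Ts st.
have bd u a b : T <= u -> `|a| <= 1 -> `|b| <= 1 -> `|G u * a + b * dG u| <= 2 * M.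
  move=> Tu a1 b1; rewrite (le_trans (ler_normD _ _))// !normrM.
  have := ler_pM (normr_ge0 _) (normr_ge0 _) (GM _ Tu) a1.
  have := ler_pM (normr_ge0 _) (normr_ge0 _) b1 (dGM _ Tu).
  lra.
rewrite /polar_curve /= -mulrBr normrM sg1 mul1r; split.
- apply: (lipschitz_on_ray (fun u => G u * cos u)
    (fun u => G u * (- sin u) + cos u * dG u) T) => // u Tu.
    by have Gu := GdG _ Tu; apply: is_derive_mulf; exact: is_derive_cos.
  by apply: bd => //; rewrite ?normrN ?sin_max ?cos_max.
- apply: (lipschitz_on_ray (fun u => G u * sin u)
    (fun u => G u * cos u + sin u * dG u) T) => // u Tu.
    by have Gu := GdG _ Tu; apply: is_derive_mulf; exact: is_derive_sin.
  by apply: bd => //; rewrite ?sin_max ?cos_max.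
Qed.

(** Whole turns are added or removed. This replaces an angle of the spiral by one on a single turn
    of the circle, and finds a prescribed direction on a given turn of the spiral. *)
Lemma angle_shift a t :
  exists t', [/\ a <= t', t' <= a + pi *+ 2, cos t' = cos t & sin t' = sin t].
Proof.
have pi2 : 0 < (pi *+ 2 : R) by rewrite pmulrn_lgt0// pi_gt0.
have [at_|ta] := leP a t.
- have ge0 : 0 <= (t - a) / (pi *+ 2) by rewrite divr_ge0 ?subr_ge0// ltW.
  have /andP[] := truncn_itv ge0; set n := Num.truncn _.
  rewrite ler_pdivlMr// ltr_pdivrMr// -natr1 => n1 n2.
  have nE := mulr_natl (pi *+ 2 : R) n.
  exists (t - (pi *+ 2) *+ n); split.
  + by rewrite -nE; lra.
  + by rewrite -nE; lra.
  + by rewrite -[in RHS](subrK ((pi *+ 2) *+ n) t) (periodicn (@cosD2pi R)).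
  + by rewrite -[in RHS](subrK ((pi *+ 2) *+ n) t) (periodicn (@sinD2pi R)).
- have ge0 : 0 <= (a - t) / (pi *+ 2) by rewrite divr_ge0 ?subr_ge0// ltW.
  have /andP[] := truncn_itv ge0; set n := Num.truncn _.
  rewrite ler_pdivlMr// ltr_pdivrMr// -natr1 => n1 n2.
  exists (t + (pi *+ 2) *+ n.+1).
  rewrite (periodicn (@cosD2pi R)) (periodicn (@sinD2pi R)).
  have <- := mulr_natl (pi *+ 2 : R) n.+1.
  by rewrite -natr1; split=> //; lra.
Qed.

(* The part before angle [T = eps^(1/p - 1)] is covered as a curve of length
   [O(T)], the rest lies within [O(eps^(1/p))] of the limit circle. *)
Lemma area_spiral_le sg G dG t0 M rho0 p C2 : `|sg| = 1 -> 1 < p -> 0 < rho0 -> 0 <= C2 ->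
  (forall t, t0 <= t -> is_derive t 1 G (dG t)) ->
  (forall t, t0 <= t -> `|G t| <= M) -> (forall t, t0 <= t -> `|dG t| <= M) ->
  (\forall t \near +oo, `|G t - rho0| <= C2 * t `^ (- (p - 1)^-1)) ->
  exists2 C, 0 < C & \forall eps \near 0^'+,
    (area (eps_nbhd (polar_curve sg G @` [set t | (t0 <= t)%R]) eps) <=
      (C * eps `^ p^-1)%:E)%E.
Proof.
move=> sg1 p1 rho00 C20 GdG GM dGM [A0 [_ GA0]].
have p0 : 0 < p by rewrite (lt_trans _ p1).
have M0 : 0 <= M by rewrite (le_trans _ (GM t0 (lexx _))).
(* Beyond [A] the decay bound holds, the spiral is defined, and angles are at least 1. *)
pose A := 1 + `|A0| + `|t0|.
have A1 : 1 <= A by rewrite /A -addrA lerDl addr_ge0.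
have A_gt0 : 0 < A by exact: lt_le_trans A1.
have t0A : t0 <= A.
  by rewrite /A; have := ler_norm t0; have := normr_ge0 A0; lra.
have A0A : A0 < A.
  by rewrite /A; have := ler_norm A0; have := normr_ge0 t0; lra.
(* [K1] pays for the turns before the cut-off angle, [K2] for the remaining ones. *)
pose K1 := 4 * (2 * M + 1) ^+ 2 * (2 + `|t0|).
pose K2 := 4 * (2 * rho0 + 1) ^+ 2 * ((pi *+ 2 + 1 + C2) * (1 + C2)).
have K10 : 0 < K1.
  by rewrite /K1 !mulr_gt0// ?exprn_gt0// ?ltr_wpDl ?mulr_ge0// ltr_pwDl.
have pi20 : 0 < (pi *+ 2 : R) by rewrite pmulrn_lgt0// pi_gt0.
have K20 : 0 <= K2.
  by apply: mulr_ge0; [rewrite mulr_ge0// sqr_ge0|apply: mulr_ge0; lra].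
exists (K1 + K2); first by rewrite ltr_pwDl.
have q0 : 0 < 1 - p^-1 by rewrite subr_gt0 invf_lt1.
near=> eps.
have e0 : 0 < eps by near: eps; exact: nbhs_right_gt.
have e1 : eps < 1 by near: eps; exact: nbhs_right_lt.
have eq0 : 0 < eps `^ (1 - p^-1) by rewrite powR_gt0.
have eqA : eps `^ (1 - p^-1) < A^-1.
  near: eps; apply: (cvgr_lt 0); last by rewrite invr_gt0.
  exact: powR_cvg0.
(* The cut-off balances the two costs: [T eps = d] is the order of the area around the early turns,
   and [T^(-1/(p-1)) = d] is the order of the distance of the late turns from the circle. *)
pose d := eps `^ p^-1; pose T := (eps `^ (1 - p^-1))^-1.
have d0 : 0 < d by rewrite powR_gt0.
have AT : A <= T by rewrite /T -[leLHS]invrK lef_pV2 ?posrE ?invr_gt0// ltW.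
have T0 : 0 < T by exact: lt_le_trans AT.
have t0T : t0 <= T by exact: le_trans AT.
have Te : T * eps = d.
  rewrite /T /d -powRN opprB -{2}[eps]powRr1 ?ltW// -powRD ?subrK//.
  by apply/implyP => _; rewrite gt_eqF.
have d1 : d <= 1.
  apply: (@le_trans _ _ (1 `^ p^-1)); last by rewrite powR1.
  by apply: ge0_ler_powR; rewrite ?nnegrE ?invr_ge0 ?(ltW p0) ?(ltW e0) ?(ltW e1).
have ed : eps <= d by rewrite -Te ler_peMl ?(ltW e0)// (le_trans A1).
have TA t : T <= t -> `|G t - rho0| <= C2 * d.
  move=> Tt; apply: (le_trans (GA0 t _)).
    by rewrite (lt_le_trans A0A)// (le_trans AT).
  rewrite ler_wpM2l// (le_trans (powR_opp_le _ _ _ _ T0 Tt))//.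
    by rewrite invr_ge0 subr_ge0 ltW.
  rewrite /T /d -powRN -powRrM le_eqVlt; apply/orP; left; apply/eqP; congr (_ `^ _).
  by field; rewrite subr_eq0 !gt_eqF.
have -> : [set t | (t0 <= t)%R] = [set t | t0 <= t <= T] `|` [set t | T <= t].
  apply/seteqP; split=> [t /= t0t|t /= [/andP[]//|Tt]]; last exact: le_trans Tt.
  by have [tT|Tt] := leP t T; [left; rewrite t0t|right; rewrite /= ltW].
rewrite image_setU eps_nbhdU (le_trans (area_setU _ _ _ _))//; try exact: measurable_eps_nbhd.
rewrite mulrDl EFinD; apply: leeD.
- apply: le_trans (area_le_curve _ (polar_curve sg G) t0 T (2 * M) eps _ _ _ _ _ _) _ => //.
  + exact: measurable_eps_nbhd.
  + by rewrite mulr_ge0.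
  + by move=> s t t0s st _; exact: (polar_curve_lipschitz _ _ dG t0).
  + move=> x [_ [t /= tT <-] /dist2_lt_coord[/ltW x1 /ltW x2]].
    by exists t => //; split.
  rewrite lee_fin.
  have -> : ((T - t0) / eps + 1) * (2 * ((2 * M + 1) * eps)) ^+ 2 =
      4 * (2 * M + 1) ^+ 2 * (T * eps - t0 * eps + eps * eps).
    by field; rewrite gt_eqF.
  rewrite Te /K1 -/d -[X in _ <= X]mulrA; apply: ler_wpM2l.
    by rewrite mulr_ge0// sqr_ge0.
  have te : - (t0 * eps) <= `|t0| * d.
    rewrite (le_trans (ler_norm _))// normrN normrM (gtr0_norm e0).
    exact: ler_wpM2l.
  have ee : eps * eps <= d by rewrite (le_trans _ ed)// ler_piMl ?ltW.
  lra.
(* The tail is covered by squares along one turn of the limit circle: its points are within [C2 d]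
   of that circle, and [eps <= d] accounts for the neighbourhood. *)
- have cd0 : 0 < (1 + C2) * d by rewrite mulr_gt0// ltr_pwDl.
  apply: le_trans (area_le_curve _ (polar_curve sg (cst rho0)) 0 (pi *+ 2) (2 * rho0)
    ((1 + C2) * d) _ _ _ _ _ _) _ => //.
  + exact: measurable_eps_nbhd.
  + exact: ltW.
  + by rewrite mulr_ge0// ltW.
  + move=> s t s0 st _; apply: (polar_curve_lipschitz sg (cst rho0) (cst 0) 0) => //.
    * by move=> u _; rewrite gtr0_norm.
    * by move=> u _; rewrite normr0 ltW.
  + move=> x [_ [t /= Tt <-] /dist2_lt_coord[/= /ltW x1 /ltW x2]].
    have [t' [t'0 t'1 ct st]] := angle_shift 0 t.
    exists t'; first by rewrite t'0 -[pi *+ 2]add0r t'1.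
    rewrite /polar_curve/= ct st.
    have GT := TA _ Tt.
    have y1 : `|(G t - rho0) * cos t| <= C2 * d.
      by rewrite normrM -[leRHS]mulr1 ler_pM// cos_max.
    have y2 : `|(G t - rho0) * sin t| <= C2 * d.
      by rewrite normrM -[leRHS]mulr1 ler_pM// sin_max.
    split.
    * have -> : x.1 - cst rho0 t' * cos t = (x.1 - G t * cos t) + (G t - rho0) * cos t.
        by rewrite /cst; ring.
      rewrite (le_trans (ler_normD _ _))//; lra.
    * have -> : x.2 - sg * (cst rho0 t' * sin t) =
          (x.2 - sg * (G t * sin t)) + sg * ((G t - rho0) * sin t).
        by rewrite /cst; ring.
      rewrite (le_trans (ler_normD _ _))// [X in _ + X]normrM sg1 mul1r; lra.
  rewrite lee_fin.
  set k := (1 + C2) * d.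
  have -> : ((pi *+ 2 - 0) / k + 1) * (2 * ((2 * rho0 + 1) * k)) ^+ 2 =
      4 * (2 * rho0 + 1) ^+ 2 * ((pi *+ 2 + k) * k).
    by field; rewrite gt_eqF.
  rewrite /K2 -/d -[X in _ <= X]mulrA; apply: ler_wpM2l.
    by rewrite mulr_ge0// sqr_ge0.
  rewrite -[X in _ <= X]mulrA -/k; apply: ler_wpM2r; first exact: ltW.
  suff : k <= 1 + C2 by lra.
  by rewrite /k -[leRHS]mulr1 ler_wpM2l// addr_ge0.
Unshelve. all: by end_near. Qed.

End polar_curves.

(** * Lower bound for the area near a spiral *)

Section spiral_lower_bound.
Context {R : realType}.
Implicit Types (G dG : R -> R) (sg s eps d t T : R).

(* Between [t*], where the spiral is at distance [w0 < d] from the limit circle,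
   and [t* + 2 pi], the radius moves by at most [2 pi C d^m < eps]. *)
Lemma annulus_subset_eps_nbhd sg s G dG t0 T rho0 m C eps d x y :
  (sg = 1 \/ sg = -1) -> (s = 1 \/ s = -1) -> t0 <= T -> 0 <= C ->
  (forall t, T <= t -> is_derive t 1 G (dG t)) ->
  (forall t, T <= t -> 0 < s * (G t - rho0)) ->
  (forall t, T <= t -> - (C * (s * (G t - rho0)) ^+ m) <= s * dG t <= 0) ->
  G t @[t --> +oo] --> rho0 ->
  d <= s * (G T - rho0) -> pi *+ 2 * (C * d ^+ m) < eps ->
  0 < x -> 0 < y -> 0 < s * (Num.sqrt (x ^+ 2 + y ^+ 2) - rho0) < d ->
  eps_nbhd (polar_curve sg G @` [set t | (t0 <= t)%R]) eps (x, y).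
Proof.
move=> sgE sE t0T C0 GdG w0 dw Gl dT de x0 y0.
set r := Num.sqrt _; set v := s * (r - rho0) => /andP[v0 vd].
pose w t := s * (G t - rho0).
have dwt t : T <= t -> is_derive t 1 w (s * dG t).
  move=> Tt; have dGt := is_derive_addf _ _ _ _ _ (GdG _ Tt) (is_derive_cst (- rho0) t 1).
  have := is_derive_mulf _ _ _ _ _ (is_derive_cst s t 1) dGt.
  by rewrite mulr0 !addr0.
have wle a b : T <= a -> a <= b -> w b <= w a.
  by move=> Ta ab; apply: (nonincreasing_on_ray w _ T dwt) => // u /dw/andP[].
have wl : w t @[t --> +oo] --> 0.
  rewrite -(mulr0 s) -(subrr rho0); apply: cvgM; first exact: cvg_cst.
  by apply: cvgB => //; exact: cvg_cst.
(* The distance falls continuously from at least [d] to the limit 0, so it takes the value [v] at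
   some angle. *)
have [t1 Tt1 wt1] : exists2 t1, T <= t1 & w t1 = v.
  near (pinfty_nbhs R) => S.
  have TS : T <= S by near: S; exact: (nbhs_pinfty_ge (num_real _)).
  have wS : w S < v by near: S; exact: (cvgr_lt 0).
  have wTS : w S <= w T by exact: wle.
  have [||c cTS wc] := IVT TS (f := w) (v := v).
  - apply: (within_continuous_is_derive _ (fun t => s * dG t)) => t.
    by rewrite in_itv/= => /andP[Tt _]; exact: dwt.
  - by rewrite min_r// max_l// (ltW wS) (le_trans (ltW vd)).
  - by exists c => //; move: cTS; rewrite in_itv/= => /andP[].
have xy0 : 0 < x ^+ 2 + y ^+ 2 by rewrite addr_gt0// exprn_gt0.
have r0 : 0 < r by rewrite sqrtr_gt0.
have rr : r ^+ 2 = x ^+ 2 + y ^+ 2 by rewrite sqr_sqrtr// ltW.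
have xr : -1 <= x / r <= 1.
  apply/andP; split; first by rewrite (le_trans (lerN10 _))// divr_ge0// ltW.
  by rewrite ler_pdivrMr// mul1r -ler_sqr ?nnegrE ?(ltW x0) ?(ltW r0)// rr lerDl sqr_ge0.
have sin_yr : sin (acos (x / r)) = y / r.
  rewrite sin_acos//.
  have -> : 1 - (x / r) ^+ 2 = (y / r) ^+ 2.
    rewrite !expr_div_n rr; field; exact: lt0r_neq0.
  by rewrite sqrtr_sqr ger0_norm// divr_ge0// ltW.
(* Since [y > 0], [acos (x / r)] is the polar angle of the point. The spiral meets this direction
   within one turn after [t1]. *)
have [t [t1t tt1 ct st]] := angle_shift t1 (sg * acos (x / r)).
have {}ct : cos t = x / r.
  by rewrite ct; case: sgE => ->; rewrite ?mul1r ?mulN1r ?cosN acosK// in_itv.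
have {}st : sg * sin t = y / r.
  by rewrite st; case: sgE => ->; rewrite ?mul1r ?mulN1r ?sinN ?opprK sin_yr.
have rG : `|r - G t| < eps.
  have -> : `|r - G t| = `|w t - w t1|.
    have -> : w t - w t1 = s * (G t - r) by rewrite wt1 /v /w; ring.
    by rewrite normrM distrC; case: sE => ->; rewrite ?normrN normr1 mul1r.
  have Tt : T <= t by exact: le_trans t1t.
  (* After [t1] the distance is at most [v], hence its speed is at most [C v^m]. *)
  apply: (@le_lt_trans _ _ (C * v ^+ m * (t - t1))).
    apply: (lipschitz_on_ray w (fun u => s * dG u) t1 (C * v ^+ m)) => // u t1u.
      by apply: dwt; exact: le_trans t1u.
    have Tu : T <= u by exact: le_trans t1u.
    have /andP[dw1 dw2] := dw _ Tu.
    rewrite ler0_norm// lerNl (le_trans _ dw1)// lerN2 ler_wpM2l//.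
    apply: lerXn2r; rewrite ?nnegrE ?(ltW v0) ?(ltW (w0 _ Tu))//.
    by rewrite -wt1; exact: wle.
  apply: le_lt_trans de; rewrite mulrC ler_pM//.
  - by rewrite subr_ge0.
  - by rewrite mulr_ge0// exprn_ge0// ltW.
  - lra.
  - by rewrite ler_wpM2l// lerXn2r ?nnegrE ?(ltW v0) ?(ltW vd)// (le_trans (ltW v0)) ?(ltW vd).
exists (polar_curve sg G t).
  by exists t => //=; rewrite (le_trans t0T)// (le_trans Tt1).
(* Both points lie on the same line through the origin, so only the radii matter. *)
have -> : dist2 (x, y) (polar_curve sg G t) = `|r - G t|; last by [].
rewrite /dist2 /polar_curve/= mulrCA st ct -sqrtr_sqr; congr Num.sqrt.
have -> : (x - G t * (x / r)) ^+ 2 + (y - G t * (y / r)) ^+ 2 =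
   (x ^+ 2 + y ^+ 2) * ((r - G t) / r) ^+ 2 by field; exact: lt0r_neq0.
by rewrite -rr -exprMn mulrC divfK// gt_eqF.
Unshelve. all: by end_near. Qed.

(** An annulus of width [d = k eps^(1/m)] adjacent to the limit circle, on the side given by [s],
    has its first-quadrant part in the neighbourhood. The vertical strip of width [rho0 / 2] already
    gives area [rho0 / 2] times [d]. *)
Lemma area_spiral_ge sg s G dG t0 T rho0 m C :
  (sg = 1 \/ sg = -1) -> (s = 1 \/ s = -1) -> (0 < m)%N -> 0 < rho0 -> t0 <= T -> 0 <= C ->
  (forall t, T <= t -> is_derive t 1 G (dG t)) ->
  (forall t, T <= t -> 0 < s * (G t - rho0)) ->
  (forall t, T <= t -> - (C * (s * (G t - rho0)) ^+ m) <= s * dG t <= 0) ->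
  G t @[t --> +oo] --> rho0 ->
  exists2 c, 0 < c & \forall eps \near 0^'+,
    ((c * eps `^ m%:R^-1)%:E <=
      area (eps_nbhd (polar_curve sg G @` [set t | (t0 <= t)%R]) eps))%E.
Proof.
move=> sgE sE m0 rho00 t0T C0 GdG w0 dw Gl.
have pi20 : 0 < (pi *+ 2 : R) by rewrite pmulrn_lgt0// pi_gt0.
(* This [k] satisfies [k <= 1] and [2 pi C k < 1]. As [k^m <= k], the radial motion [2 pi C d^m]
   during one turn is less than [eps]. *)
pose k := (1 + pi *+ 2 * C)^-1.
have k1 : 1 <= 1 + pi *+ 2 * C by rewrite lerDl mulr_ge0// ltW.
have k0 : 0 < k by rewrite invr_gt0 (lt_le_trans _ k1).
have kle1 : k <= 1 by rewrite invf_le1// (lt_le_trans _ k1).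
exists (rho0 / 2 * k); first by rewrite mulr_gt0// divr_gt0.
have mR : 0 < m%:R^-1 :> R by rewrite invr_gt0 ltr0n.
near=> eps.
have e0 : 0 < eps by near: eps; exact: nbhs_right_gt.
(* The first bound makes the spiral at [T] lie farther out than [d]; the second keeps the inner
   radius [rho0 - d] above [rho0 / 2]. *)
have emT : eps `^ m%:R^-1 < Num.min (s * (G T - rho0)) (rho0 / 2).
  near: eps; apply: (cvgr_lt 0); first exact: powR_cvg0.
  by rewrite lt_min w0//= divr_gt0.
move: emT; rewrite lt_min => /andP[emT emr].
pose d := k * eps `^ m%:R^-1.
have em0 : 0 < eps `^ m%:R^-1 by rewrite powR_gt0.
have d0 : 0 < d by rewrite mulr_gt0.
have de : d <= eps `^ m%:R^-1 by rewrite ler_piMl// ltW.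
have dm : pi *+ 2 * (C * d ^+ m) < eps.
  rewrite exprMn -[X in k ^+ m * X]powR_mulrn ?(ltW em0)// -powRrM mulVf ?pnatr_eq0 -?lt0n//.
  rewrite powRr1 ?(ltW e0)//.
  have km : k ^+ m <= k by rewrite -[leRHS]expr1 ler_wiXn2l// ?ltW.
  apply: (@le_lt_trans _ _ (pi *+ 2 * C * k * eps)).
    have pC : 0 <= pi *+ 2 * C by rewrite mulr_ge0// ltW.
    by rewrite [leLHS]mulrA -[leRHS]mulrA ler_wpM2l// ler_wpM2r// ltW.
  rewrite -[X in _ < X]mul1r ltr_pM2r// /k ltr_pdivrMr ?mul1r; first by rewrite ltrDr.
  exact: lt_le_trans k1.
rewrite -mulrA -/d.
case: (sE) => sE1.
- apply: (area_ge_annulus _ rho0) => //.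
  + exact: measurable_eps_nbhd.
  + by rewrite divr_gt0.
  + lra.
  + move=> x y x0 xh y0 rxy rdxy.
    apply: (annulus_subset_eps_nbhd sg s G dG t0 T rho0 m C eps d) => //.
      by rewrite (le_trans de)// ltW.
    have rd0 : 0 <= rho0 + d by rewrite addr_ge0 ?ltW.
    have xy0 : 0 <= x ^+ 2 + y ^+ 2 by rewrite addr_ge0// sqr_ge0.
    set r := Num.sqrt _.
    have rr : r ^+ 2 = x ^+ 2 + y ^+ 2 by rewrite sqr_sqrtr.
    have r0 : 0 <= r by rewrite sqrtr_ge0.
    have rlo : rho0 < r by rewrite -ltr_sqr ?nnegrE ?(ltW rho00)// rr.
    have rhi : r < rho0 + d by rewrite -ltr_sqr ?nnegrE ?(ltW rho00)// rr.
    by rewrite sE1; apply/andP; split; lra.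
- apply: (area_ge_annulus _ (rho0 - d)) => //.
  + exact: measurable_eps_nbhd.
  + by rewrite divr_gt0.
  + lra.
  + move=> x y x0 xh y0 rxy; rewrite subrK => rdxy.
    apply: (annulus_subset_eps_nbhd sg s G dG t0 T rho0 m C eps d) => //.
      by rewrite (le_trans de)// ltW.
    have rd0 : 0 <= rho0 - d by lra.
    have xy0 : 0 <= x ^+ 2 + y ^+ 2 by rewrite addr_ge0// sqr_ge0.
    set r := Num.sqrt _.
    have rr : r ^+ 2 = x ^+ 2 + y ^+ 2 by rewrite sqr_sqrtr.
    have r0 : 0 <= r by rewrite sqrtr_ge0.
    have rlo : rho0 - d < r by rewrite -ltr_sqr ?nnegrE ?(ltW rho00)// rr.
    have rhi : r < rho0 by rewrite -ltr_sqr ?nnegrE ?(ltW rho00)// rr.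
    by rewrite sE1; apply/andP; split; lra.
Unshelve. all: by end_near. Qed.

End spiral_lower_bound.

(** * Box dimension from the growth of the area *)

Section box_dimension.
Context {R : realType}.
Implicit Types (B : set (R * R)).

Lemma limf_ge (f : R -> \bar R) (F : set_system R) {FF : ProperFilter F} (c : \bar R) :
  F [set x | (c <= f x)%E] -> (c <= limf_einf f F)%E /\ (c <= limf_esup f F)%E.
Proof.
move=> cf; split.
- rewrite limf_einfE; apply: le_ereal_sup_tmp.
  exists (ereal_inf (f @` [set x | (c <= f x)%E])); first by exists [set x | (c <= f x)%E].
  by apply: le_ereal_inf_tmp => _ [x /= cfx <-].
- rewrite limf_esupE; apply: le_ereal_inf_tmp => _ [V FV <-].
  have /filter_ex[x [Vx cfx]] : F (V `&` [set x | (c <= f x)%E]) by exact: filterI.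
  by apply: le_ereal_sup_tmp; exists (f x) => //; exists x.
Qed.

Lemma limf_le (f : R -> \bar R) (F : set_system R) {FF : ProperFilter F} (c : \bar R) :
  F [set x | (f x <= c)%E] -> (limf_einf f F <= c)%E /\ (limf_esup f F <= c)%E.
Proof.
move=> fc; split.
- rewrite limf_einfE; apply: ge_ereal_sup => _ [V FV <-].
  have /filter_ex[x [Vx fxc]] : F (V `&` [set x | (f x <= c)%E]) by exact: filterI.
  by apply: ge_ereal_inf; exists (f x) => //; exists x.
- rewrite limf_esupE; apply: ge_ereal_inf.
  exists (ereal_sup (f @` [set x | (f x <= c)%E])); first by exists [set x | (f x <= c)%E].
  by apply: ge_ereal_sup => _ [x /= fxc <-].
Qed.

Lemma ereal_inf_threshold (S : set R) (d : R) : (forall s, d < s -> S s) ->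
  (forall s, S s -> d <= s) -> ereal_inf [set s%:E | s in S] = d%:E.
Proof.
move=> Sgt Sge; apply/eqP; rewrite eq_le; apply/andP; split; last first.
  by apply: le_ereal_inf_tmp => _ [s Ss <-]; rewrite lee_fin Sge.
apply/lee_addgt0Pr => e e0; apply: ge_ereal_inf; exists (d + e)%:E => //.
by exists (d + e) => //; apply: Sgt; rewrite ltrDl.
Qed.

(** The dimension only sees exponents: an upper bound for each [p] slightly above [m] is enough, and
    it tolerates the logarithm present when [m = 1]. The lower bound is used at the exact
    exponent. *)
Lemma box_dim_area_growth B m : (0 < m)%N ->
  (exists2 c : R, 0 < c & \forall eps \near 0^'+,
    ((c * eps `^ m%:R^-1)%:E <= area (eps_nbhd B eps))%E) ->
  (forall p : R, 1 < p -> m%:R <= p -> exists2 C : R, 0 < C & \forall eps \near 0^'+,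
    (area (eps_nbhd B eps) <= (C * eps `^ p^-1)%:E)%E) ->
  box_dim_eq B (2 - m%:R^-1).
Proof.
move=> m0 [c c0 lower] upper.
have small s : 2 - m%:R^-1 < s ->
    limf_einf (box_ratio B s) 0^'+ = 0%E /\ limf_esup (box_ratio B s) 0^'+ = 0%E.
  move=> ds.
  have mR : 0 < m%:R^-1 :> R by rewrite invr_gt0 ltr0n.
  have m1 : m%:R^-1 <= 1 :> R by rewrite invf_le1 ?ltr0n// ler1n.
  (* An exponent [v] strictly between [2 - s] and [1/m] is needed, so that [p = 1/v] makes the ratio
     [O(eps^(v - (2 - s)))], which tends to 0. The maximum with 0 keeps [v] positive for large
     [s]. *)
  pose u := Num.max (2 - s) 0; pose v := (u + m%:R^-1) / 2.
  have um : u < m%:R^-1 by rewrite gt_max mR andbT; lra.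
  have u0 : 0 <= u by rewrite le_max lexx orbT.
  have us : 2 - s <= u by rewrite le_max lexx.
  have v0 : 0 < v by rewrite /v; lra.
  have vm : v < m%:R^-1 by rewrite /v; lra.
  have sv : 0 < v - (2 - s) by rewrite /v; lra.
  have p1 : 1 < v^-1 by rewrite invf_gt1//; lra.
  have mp : m%:R <= v^-1 by rewrite -[leLHS]invrK lef_pV2 ?posrE// ltW.
  have [C C0 {}upper] := upper _ p1 mp.
  have ratio_ge0 : \forall x \near 0^'+, (0 <= box_ratio B s x)%E.
    by near=> x; rewrite /box_ratio mule_ge0// lee_fin invr_ge0 powR_ge0.
  have ratio_le e : 0 < e -> \forall x \near 0^'+, (box_ratio B s x <= e%:E)%E.
    move=> e0; near=> x.
    have x0 : 0 < x by near: x; exact: nbhs_right_gt.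
    have xe : x `^ (v - (2 - s)) < e / C.
      near: x; apply: (cvgr_lt 0); last exact: divr_gt0.
      exact: powR_cvg0.
    apply: (@le_trans _ _ ((C * x `^ v)%:E * ((x `^ (2 - s))^-1)%:E)%E).
      apply: lee_wpmul2r; first by rewrite lee_fin invr_ge0 powR_ge0.
      by near: x; move: upper; rewrite invrK.
    rewrite -EFinM lee_fin -mulrA -powRB; last by apply/implyP => _; rewrite gt_eqF.
    by rewrite mulrC -ler_pdivlMr// ltW.
  have [ge0 ge0'] := @limf_ge _ _ (at_right_proper_filter 0) _ ratio_ge0.
  split; apply/eqP; rewrite eq_le ?ge0 ?ge0' andbT; apply/lee_addgt0Pr => e e0;
    by rewrite add0e; have [] := @limf_le _ _ (at_right_proper_filter 0) _ (ratio_le _ e0).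
(* Here the exponent [1/m - (2 - s)] is negative, so the ratio is at least [c] for [eps <= 1]. *)
have large s : s < 2 - m%:R^-1 ->
    (0 < limf_einf (box_ratio B s) 0^'+)%E /\ (0 < limf_esup (box_ratio B s) 0^'+)%E.
  move=> sd.
  suff cr : \forall x \near 0^'+, (c%:E <= box_ratio B s x)%E.
    have [c1 c2] := @limf_ge _ _ (at_right_proper_filter 0) _ cr.
    by split; [apply: lt_le_trans c1|apply: lt_le_trans c2]; rewrite lte_fin.
  near=> x.
  have x0 : 0 < x by near: x; exact: nbhs_right_gt.
  have x1 : x <= 1 by near: x; exact: nbhs_right_le.
  apply: (@le_trans _ _ ((c * x `^ m%:R^-1)%:E * ((x `^ (2 - s))^-1)%:E)%E); last first.
    apply: lee_wpmul2r; first by rewrite lee_fin invr_ge0 powR_ge0.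
    by near: x; exact: lower.
  rewrite -EFinM lee_fin -mulrA -powRB; last by apply/implyP => _; rewrite gt_eqF.
  rewrite ler_peMr ?(ltW c0)// -[X in X <= _](powRr0 x); apply: ger_powR; first by rewrite x0.
  lra.
split; apply: ereal_inf_threshold => s.
- by move=> /small[].
- by move=> /= s0; rewrite leNgt; apply/negP => /large[_]; rewrite s0 ltxx.
- by move=> /small[].
- by move=> /= s0; rewrite leNgt; apply/negP => /large[+ _]; rewrite s0 ltxx.
Unshelve. all: by end_near. Qed.

End box_dimension.

(** * Trajectories normalized to forward angles *)

Section normalized_trajectory.
Context {R : realType}.
Implicit Types (f k G : R -> R) (t T : R).

(** The difference quotients are bounded near 0. Applied to [k] at [rho0], this gives the estimate
    [|K - kappa| <= L w] behind the exponential case. *)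
Lemma derivable_lipschitz_at f (x0 : R) : derivable f x0 1 ->
  exists2 L, 0 <= L & \forall x \near x0, `|f x - f x0| <= L * `|x - x0|.
Proof.
move=> /cvg_ex[/= l fl]; exists (`|l| + 1); first by rewrite addr_ge0.
have : \forall h \near 0^', `|h^-1 *: (f (h *: 1 + x0) - f x0)| < `|l| + 1.
  apply: (cvgr_lt `|l|); last by rewrite ltrDl.
  by apply: cvg_norm; exact: fl.
rewrite near_withinE => H; rewrite (near_shift 0)/= subr0; near=> h; rewrite /= addrK.
have [->|h0] := eqVneq h 0; first by rewrite add0r subrr !normr0 mulr0.
have : h != 0 -> `|h^-1 *: (f (h *: 1 + x0) - f x0)| < `|l| + 1 by near: h.
move=> /(_ h0)/ltW; rewrite /GRing.scale/= mulr1 normrM normfV.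
by rewrite mulrC ler_pdivrMr// normr_gt0.
Unshelve. all: by end_near. Qed.

Lemma bounded_on_ray f T (l : R) : (forall t, T <= t -> {for t, continuous f}) ->
  f t @[t --> +oo] --> l -> exists M, forall t, T <= t -> `|f t| <= M.
Proof.
move=> cf fl.
have [A [_ fA]] : \forall t \near +oo, `|f t| < `|l| + 1.
  by apply: (cvgr_lt `|l|); [exact: cvg_norm|rewrite ltrDl].
pose S := Num.max T (A + 1).
have TS : T <= S by rewrite le_max lexx.
have [|c _ cmax] := EVT_max (f := fun t => `|f t|) TS.
  apply: continuous_in_subspaceT => t; rewrite inE/= in_itv/= => /andP[Tt _].
  by apply: continuous_comp; [exact: cf|exact: norm_continuous].
exists (Num.max `|f c| (`|l| + 1)) => t Tt; rewrite le_max.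
have [tS|St] := leP t S; first by rewrite cmax// in_itv/= Tt.
apply/orP; right; apply/ltW/fA; apply: lt_trans St.
by rewrite lt_max (ltrDl A 1) ltr01 orbT.
Qed.

Lemma sign_sqr (s : R) : (s = 1) \/ (s = -1) -> s * s = 1.
Proof. by case=> ->; ring. Qed.

(** Three signs treat all cases at once: [s] is the side of the circle, [tau] the direction of the
    angle, [sg] the orientation of the curve. The distance [w = s (G - rho0)] then satisfies
    [w' = - w^m K]. *)
Lemma normalized_trajectory (sg s tau rho0 : R) m k G t0 :
  (sg = 1 \/ sg = -1) -> (s = 1 \/ s = -1) -> (tau = 1 \/ tau = -1) ->
  (0 < m)%N -> 0 < rho0 -> (forall x, 0 < x -> derivable k x 1) -> k rho0 != 0 ->
  (forall t, t0 <= t -> 0 < G t) -> (forall t, t0 <= t -> 0 < s * (G t - rho0)) ->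
  (forall t, t0 <= t -> is_derive t 1 G (- (tau * ((G t - rho0) ^+ m * k (G t))))) ->
  G t @[t --> +oo] --> rho0 ->
  [/\ box_dim_eq (polar_curve sg G @` [set t | (t0 <= t)%R]) (2 - m%:R^-1),
   (m = 1%N -> exists c1 c2 : R, [/\ 0 < c1, 0 < c2 & \forall t \near +oo,
      c1 * expR (- (k rho0 * (tau * t))) <= s * (G t - rho0) <=
      c2 * expR (- (k rho0 * (tau * t)))]) &
   ((1 < m)%N -> exists c1 c2 : R, [/\ 0 < c1, 0 < c2 & \forall t \near +oo,
      c1 * t `^ (- (m%:R - 1)^-1) <= s * (G t - rho0) <=
      c2 * t `^ (- (m%:R - 1)^-1)])].
Proof.
move=> sgE sE tauE m0 rho00 dk krho0 G0 w0 GdG Gl.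
have ss := sign_sqr _ sE; have tt := sign_sqr _ tauE.
have s1 : `|s| = 1 by case: sE => ->; rewrite ?normrN normr1.
pose w t := s * (G t - rho0).
(* As [G - rho0 = s w], the factor [s] of [w] and the power [s^m] of the field combine to
   [s^(m+1)]. *)
pose K t := tau * s ^+ m.+1 * k (G t).
pose kappa := tau * s ^+ m.+1 * k rho0.
pose dG t := - (tau * ((G t - rho0) ^+ m * k (G t))).
have wG t : t0 <= t -> `|G t - rho0| = w t.
  by move=> Tt; rewrite -[LHS]mul1r -s1 -normrM gtr0_norm// w0.
have sdG t : s * dG t = - (w t ^+ m * K t).
  rewrite /dG /w /K exprMn exprS.
  have -> : s ^+ m * (G t - rho0) ^+ m * (tau * (s * s ^+ m) * k (G t)) =
    (s * s) ^+ m * (s * (tau * ((G t - rho0) ^+ m * k (G t)))) by rewrite exprMn; ring.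
  by rewrite ss expr1n mul1r mulrN.
have dwt t : t0 <= t -> is_derive t 1 w (- (w t ^+ m * K t)).
  move=> Tt; have dGt := is_derive_addf _ _ _ _ _ (GdG _ Tt) (is_derive_cst (- rho0) t 1).
  have := is_derive_mulf _ _ _ _ _ (is_derive_cst s t 1) dGt.
  by rewrite mulr0 !addr0 -sdG.
have kcont x : 0 < x -> {for x, continuous k}.
  by move=> /dk /derivable1_diffP /differentiable_continuous.
have Gcont t : t0 <= t -> {for t, continuous G}.
  by move=> /GdG/@ex_derive/derivable1_diffP/differentiable_continuous.
have wl : w t @[t --> +oo] --> 0.
  rewrite -(mulr0 s) -(subrr rho0); apply: cvgM; first exact: cvg_cst.
  by apply: cvgB => //; exact: cvg_cst.
have kGl : k (G t) @[t --> +oo] --> k rho0.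
  by apply: (cvg_comp G k Gl); exact: kcont.
have Kl : K t @[t --> +oo] --> kappa by apply: cvgM => //; exact: cvg_cst.
(* The sign is not computed: convergence to the circle forces it, nonvanishing being clear. *)
have kappa0 : 0 < kappa.
  apply: (radial_rate_gt0 m w K t0 kappa) => //.
  rewrite /kappa; case: tauE => ->; case: sE => ->; rewrite !mulf_neq0// ?expf_neq0// ?oppr_eq0 oner_eq0.
have [L L0 kL] := derivable_lipschitz_at _ _ (dk _ rho00).
have [T [t0T Kge Kle w1 Klip]] : exists T, [/\ t0 <= T, forall t, T <= t -> kappa / 2 <= K t,
    forall t, T <= t -> K t <= 2 * kappa, forall t, T <= t -> w t <= 1 &
    forall t, T <= t -> `|K t - kappa| <= L * w t].
  have [A [_ HA]] : \forall t \near +oo, [/\ kappa / 2 <= K t, K t <= 2 * kappa, w t <= 1 &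
      `|k (G t) - k rho0| <= L * `|G t - rho0|].
    near=> t; split; near: t.
    - apply: (cvgr_ge kappa) => //; lra.
    - apply: (cvgr_le kappa) => //; lra.
    - exact: (cvgr_le 0).
    - exact: (Gl _ kL).
  exists (Num.max t0 (A + 1)).
  have TA t : Num.max t0 (A + 1) <= t -> t0 <= t /\ A < t.
    by rewrite ge_max => /andP[? At]; split=> //; rewrite (lt_le_trans _ At)// ltrDl.
  split; first by rewrite le_max lexx.
  - by move=> t /TA[_ /HA[]].
  - by move=> t /TA[_ /HA[]].
  - by move=> t /TA[_ /HA[]].
  - move=> t /TA[t0t /HA[_ _ _]]; rewrite wG//; apply: le_trans.
    rewrite /K /kappa -mulrBr !normrM normrX s1 expr1n mulr1.
    by case: tauE => ->; rewrite ?normrN normr1 mul1r.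
have w0T t : T <= t -> 0 < w t by move=> Tt; rewrite w0// (le_trans t0T).
have dwT t : T <= t -> is_derive t 1 w (- (w t ^+ m * K t)).
  by move=> Tt; apply: dwt; exact: le_trans Tt.
split.
- apply: box_dim_area_growth => //.
    apply: (area_spiral_ge sg s G dG t0 T rho0 m (2 * kappa)) => //.
    + by rewrite mulr_ge0// ltW.
    + by move=> t Tt; apply: GdG; exact: le_trans Tt.
    + move=> t Tt; have wm0 : 0 <= w t ^+ m by rewrite exprn_ge0// ltW// w0T.
      rewrite sdG lerN2 oppr_le0 [X in _ <= X]mulrC ler_wpM2l ?Kle//=.
      by rewrite mulr_ge0// (le_trans _ (Kge _ Tt))// divr_ge0// ltW.
  move=> p p1 mp.
  have [M1 GM] := bounded_on_ray G t0 rho0 Gcont Gl.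
  have [M2 dGM] : exists M, forall t, t0 <= t -> `|dG t| <= M.
    apply: (bounded_on_ray dG t0 (- (tau * ((rho0 - rho0) ^+ m * k rho0)))).
      move=> t t0t; rewrite /dG; apply: cvgN; apply: cvgM; first exact: cvg_cst.
      apply: cvgM; last by apply: (cvg_comp G k (Gcont _ t0t)); exact/kcont/G0.
      apply: (cvg_comp (fun u => G u - rho0) (fun u => u ^+ m)); last exact: exprn_continuous.
      by apply: cvgB; [exact: Gcont|exact: cvg_cst].
    rewrite /dG; apply: cvgN; apply: cvgM; first exact: cvg_cst.
    apply: cvgM => //.
    apply: (cvg_comp (fun u => G u - rho0) (fun u => u ^+ m)); last exact: exprn_continuous.
    by apply: cvgB => //; exact: cvg_cst.
  have [C2 C20 wC2] : exists2 C, 0 < C & \forall t \near +oo, w t <= C * t `^ (- (p - 1)^-1).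
    apply: (radial_power_le w (fun t => w t ^+ m * K t) T p (kappa / 2)) => //.
      by rewrite divr_gt0.
    (* From [w <= 1] and [m <= p] follows [w^p <= w^m], so the decay estimate applies with exponent
       [p]. *)
    move=> t Tt; rewrite mulrC ler_pM ?powR_ge0//; [by rewrite divr_ge0// ltW| |exact: Kge].
    by rewrite -powR_mulrn ?(ltW (w0T _ Tt))//; apply: ger_powR => //; rewrite w0T ?w1.
  apply: (area_spiral_le sg G dG t0 (Num.max M1 M2) rho0 p C2) => //.
  + by case: sgE => ->; rewrite ?normrN normr1.
  + exact: ltW.
  + by move=> t /GM GtM; rewrite le_max GtM.
  + by move=> t /dGM GtM; rewrite le_max GtM orbT.
  + near=> t; rewrite wG; first by near: t.
    by near: t; exact: (nbhs_pinfty_ge (num_real _)).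
- move=> m1; rewrite m1 in dwT.
  (* For [m = 1] the side enters as [s^2 = 1], so the exponent is the same outside and inside. *)
  have kE : kappa = k rho0 * tau by rewrite /kappa m1 expr2 ss mulr1 mulrC.
  have [c1 [c2 [c10 c20 wc]]] := radial_exponential w K T kappa L kappa0 L0 w0T dwT Kge Klip.
  exists c1, c2; split=> //; near=> t; rewrite mulrA -kE; apply: wc.
  by near: t; exact: (nbhs_pinfty_ge (num_real _)).
- move=> m1.
  have mR : 1 < m%:R :> R by rewrite ltr1n.
  have [c2 c20 wc2] : exists2 C, 0 < C & \forall t \near +oo, w t <= C * t `^ (- (m%:R - 1)^-1).
    apply: (radial_power_le w (fun t => w t ^+ m * K t) T m%:R (kappa / 2)) => //.
      by rewrite divr_gt0.
    move=> t Tt; rewrite powR_mulrn ?(ltW (w0T _ Tt))// mulrC ler_wpM2l ?Kge//.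
    by rewrite exprn_ge0// ltW// w0T.
  have [c1 c10 wc1] : exists2 C, 0 < C & \forall t \near +oo, C * t `^ (- (m%:R - 1)^-1) <= w t.
    apply: (radial_power_ge w (fun t => w t ^+ m * K t) T m%:R (2 * kappa)) => //.
      by rewrite mulr_gt0.
    move=> t Tt; rewrite powR_mulrn ?(ltW (w0T _ Tt))// [leRHS]mulrC ler_wpM2l ?Kle//.
    by rewrite exprn_ge0// ltW// w0T.
  by exists c1, c2; split=> //; near=> t; apply/andP; split; near: t.
Unshelve. all: by end_near. Qed.

End normalized_trajectory.

(** * Return to the given angle and conclusion *)

Definition ray_sign (R : realType) (up : bool) : R := if up then 1 else -1.

Lemma near_ray_end (R : realType) (up : bool) (P : R -> Prop) :
  (\forall t \near +oo, P (ray_sign R up * t)) -> \forall phi \near @ray_end R up, P phi.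
Proof.
case: up; rewrite /ray_sign /ray_end => -[A [Ar AP]].
- by exists A; split=> // x /AP; rewrite mul1r.
- exists (- A); split; first by rewrite realN.
  by move=> x xA; have := AP (- x); rewrite mulN1r opprK; apply; rewrite ltrNr.
Qed.

Lemma spiral_polar_curve (R : realType) (up : bool) (phi0 : R) (F : R -> R) :
  spiral up phi0 F = polar_curve (ray_sign R up) (fun t => F (ray_sign R up * t)) @`
    [set t | (ray_sign R up * phi0 <= t)%R].
Proof.
rewrite /spiral /polar_curve /ray_sign /ray; apply/seteqP; split=> [_ [t + <-]|_ [t /= + <-]];
  case: up => /= Ht.
- by exists t; rewrite /= ?mul1r.
- exists (- t); rewrite /= ?mulN1r ?lerN2// ?opprK.
  by rewrite cosN sinN mulrN opprK.
- by rewrite !mul1r in Ht *; exists t.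
- rewrite !mulN1r in Ht *; exists (- t); first by rewrite lerNl.
  by rewrite cosN sinN mulrN.
Qed.

(** The substitution [phi = tau t] reduces either direction of accumulation to the normalized one.
    In the power case [t = |phi|], while in the exponential case the sign of [phi] is kept, so that
    one [beta] serves both directions. *)
Lemma trajectory_comparable_dim (R : realType) (l : nat) (a : 'I_l -> R) (rho0 : R) (m : nat)
    (k : R -> R) (up : bool) (s phi0 : R) (F : R -> R) :
  0 < rho0 -> (0 < m)%N -> (forall x, 0 < x -> derivable k x 1) -> k rho0 != 0 ->
  (forall x, 0 < x -> x * cyc_fun a x = (x - rho0) ^+ m * k x) ->
  (s = 1 \/ s = -1) -> traj_part a rho0 up phi0 F ->
  (forall phi, ray up phi0 phi -> 0 < s * (F phi - rho0)) ->
  [/\ box_dim_eq (spiral up phi0 F) (2 - m%:R^-1),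
    m = 1%N -> spiral_comparable up rho0 F (fun phi => expR (- (k rho0 * phi))) &
    (1 < m)%N -> spiral_comparable up rho0 F (fun phi => `|phi| `^ (- (m%:R - 1)^-1))].
Proof.
move=> rho00 m0 dk krho0 kE sE [F0 [dF Fl]] Fs.
pose tau := ray_sign R up.
have tauE : tau = 1 \/ tau = -1 by rewrite /tau /ray_sign; case: up {F0 dF Fl Fs tau}; [left|right].
have tau_ray t : tau * phi0 <= t -> ray up phi0 (tau * t).
  rewrite /tau /ray /ray_sign; case: (up); first by rewrite !mul1r.
  by rewrite !mulN1r lerNl.
have s1 : `|s| = 1 by case: sE => ->; rewrite ?normrN normr1.
have Fabs phi : ray up phi0 phi -> `|F phi - rho0| = s * (F phi - rho0).
  by move=> Hphi; rewrite -[LHS]mul1r -s1 -normrM gtr0_norm// Fs.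
pose G t := F (tau * t).
have Gl : G t @[t --> +oo] --> rho0.
  move: Fl; rewrite /G /tau /ray_end /ray_sign; case: (up).
    by under [in X in _ -> X]eq_fun do rewrite mul1r.
  move=> /cvgNy_compNP; rewrite /comp.
  by under [in X in _ -> X]eq_fun do rewrite mulN1r.
have dG t : tau * phi0 <= t ->
    is_derive t 1 G (- (tau * ((G t - rho0) ^+ m * k (G t)))).
  move=> /tau_ray Ht; have dFt := dF _ Ht.
  have := @is_derive1_comp _ F (fun u => tau * u) t _ tau dFt (is_derive_mulr tau t).
  rewrite -kE; last exact: F0.
  by rewrite mulNr [_ * tau]mulrC.
have [dim exp pow] := normalized_trajectory tau s tau rho0 m k G (tau * phi0)
  tauE sE tauE m0 rho00 dk krho0 (fun t Ht => F0 _ (tau_ray t Ht))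
  (fun t Ht => Fs _ (tau_ray t Ht)) dG Gl.
split.
- by rewrite spiral_polar_curve.
- move=> /exp[c1 [c2 [c10 c20 wc]]]; exists c1, c2; do 2 split=> //.
  apply: near_ray_end; rewrite -/tau; near=> t.
  have Ht : tau * phi0 <= t by near: t; exact: (nbhs_pinfty_ge (num_real _)).
  by rewrite (Fabs _ (tau_ray _ Ht)); apply/andP; near: t.
- move=> /pow[c1 [c2 [c10 c20 wc]]]; exists c1, c2; do 2 split=> //.
  apply: near_ray_end; rewrite -/tau; near=> t.
  have Ht : tau * phi0 <= t by near: t; exact: (nbhs_pinfty_ge (num_real _)).
  have t0 : 0 < t by near: t; exact: (nbhs_pinfty_gt (num_real _)).
  have -> : `|tau * t| = t.
    by rewrite normrM (gtr0_norm t0); case: tauE => ->; rewrite ?normrN normr1 mul1r.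
  by rewrite (Fabs _ (tau_ray _ Ht)); apply/andP; near: t.
Unshelve. all: by end_near. Qed.

Theorem theorem4p2 (R : realType) (l : nat) (a : 'I_l -> R) (rho0 : R) (m : nat) :
  (1 <= l)%N -> 0 < rho0 ->
  (1 <= m)%N -> (m <= l)%N -> zero_mult (cyc_fun a) rho0 m ->
  (m = 1%N ->
     exists beta : R, beta != 0 /\
     forall (up1 up2 : bool) (phi1 phi2 : R) (F1 F2 : R -> R),
       traj_part a rho0 up1 phi1 F1 -> (forall phi, ray up1 phi1 phi -> rho0 < F1 phi) ->
       traj_part a rho0 up2 phi2 F2 -> (forall phi, ray up2 phi2 phi -> F2 phi < rho0) ->
       spiral_comparable up1 rho0 F1 (fun phi => expR (- (beta * phi))) /\
       spiral_comparable up2 rho0 F2 (fun phi => expR (- (beta * phi))) /\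
       box_dim_eq (spiral up1 phi1 F1) (2 - (m%:R)^-1) /\
       box_dim_eq (spiral up2 phi2 F2) (2 - (m%:R)^-1)) /\
  ((1 < m)%N ->
     forall (up1 up2 : bool) (phi1 phi2 : R) (F1 F2 : R -> R),
       traj_part a rho0 up1 phi1 F1 -> (forall phi, ray up1 phi1 phi -> rho0 < F1 phi) ->
       traj_part a rho0 up2 phi2 F2 -> (forall phi, ray up2 phi2 phi -> F2 phi < rho0) ->
       spiral_comparable up1 rho0 F1 (fun phi => `|phi| `^ (- ((m%:R - 1)^-1))) /\
       spiral_comparable up2 rho0 F2 (fun phi => `|phi| `^ (- ((m%:R - 1)^-1))) /\
       box_dim_eq (spiral up1 phi1 F1) (2 - (m%:R)^-1) /\
       box_dim_eq (spiral up2 phi2 F2) (2 - (m%:R)^-1)).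
Proof.
move=> _ rho00 m0 _ gm.
have [k [dk krho0 kE]] := cyc_fun_factor _ _ _ _ _ rho00 gm.
have outer up phi F : (forall x, ray up phi x -> rho0 < F x) ->
    forall x, ray up phi x -> 0 < 1 * (F x - rho0).
  by move=> Frho x /Frho; rewrite mul1r subr_gt0.
have inner up phi F : (forall x, ray up phi x -> F x < rho0) ->
    forall x, ray up phi x -> 0 < -1 * (F x - rho0).
  by move=> Frho x /Frho; rewrite mulN1r opprB subr_gt0.
(* The constant [k rho0] comes from the field alone and is fixed before the trajectories; for
   [m = 1] it is [rho0] times the derivative of [cyc_fun a] at [rho0]. Outside corresponds to
   [s = 1], inside to [s = -1]. *)
split=> [m1|m1]; [exists (k rho0); split=> //|];
  move=> up1 up2 phi1 phi2 F1 F2 T1 /outer F1rho T2 /inner F2rho.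
- have [d1 /(_ m1) e1 _] := trajectory_comparable_dim _ _ _ _ _ _ _ _ _ _ rho00 m0 dk krho0 kE
    (or_introl erefl) T1 F1rho.
  have [d2 /(_ m1) e2 _] := trajectory_comparable_dim _ _ _ _ _ _ _ _ _ _ rho00 m0 dk krho0 kE
    (or_intror erefl) T2 F2rho.
  by [].
- have [d1 _ /(_ m1) e1] := trajectory_comparable_dim _ _ _ _ _ _ _ _ _ _ rho00 m0 dk krho0 kE
    (or_introl erefl) T1 F1rho.
  have [d2 _ /(_ m1) e2] := trajectory_comparable_dim _ _ _ _ _ _ _ _ _ _ rho00 m0 dk krho0 kE
    (or_intror erefl) T2 F2rho.
  by [].
Qed.
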